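(* There exists a family of linear loss functions over the probability simplex $\mathbf{\Delta}_2=\{x\in\mathbb R^2:x_1+x_2=1,\ x\ge0\}$ in two dimensions such that the algorithm that starts at $x^{(1)}=(1/2,1/2)$ and alternates between the updates for online projected gradient descent and online exponentiated gradient at each time step incurs regret $\Omega(T)$, irrespective of any fixed step sizes for online projected gradient descent and online exponentiated gradient.
   Context: In online convex optimization over horizon $T$, at each time step $t=1,\dots,T$ the algorithm plays $x^{(t)}\in\mathbf{\Delta}_2$ and then observes the loss function $f^{(t)}$. Its regret is $\sum_{t=1}^Tf^{(t)}(x^{(t)})-\min_{x\in\mathbf{\Delta}_2}\sum_{t=1}^Tf^{(t)}(x)$. The loss functions come from an oblivious adversary: the (possibly random) sequence $f^{(1)},\dots,f^{(T)}$ is fixed before play and does not depend on the player's moves. The alternating algorithm uses two fixed step sizes $\eta_{\mathrm{euc}},\eta_{\mathrm{ent}}>0$. On odd $t$ it makes the online projected gradient descent update $x^{(t+1)}=\Pi_{\mathbf{\Delta}_2}\big(x^{(t)}-\eta_{\mathrm{euc}}\nabla f^{(t)}(x^{(t)})\big)$, where $\Pi_{\mathbf{\Delta}_2}$ is Euclidean projection onto $\mathbf{\Delta}_2$. On even $t$ it makes the online exponentiated gradient update $x^{(t+1)}_i=\dfrac{x^{(t)}_i\exp(-\eta_{\mathrm{ent}}\nabla_if^{(t)}(x^{(t)}))}{\sum_jx^{(t)}_j\exp(-\eta_{\mathrm{ent}}\nabla_jf^{(t)}(x^{(t)}))}$. *)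

(* Defs.v *)
From HB Require Import structures.
From mathcomp Require Import all_boot all_order all_algebra.
From mathcomp Require Import all_classical all_reals all_analysis.

Set Implicit Arguments.
Unset Strict Implicit.
Unset Printing Implicit Defensive.

Import Order.TTheory GRing.Theory Num.Theory.
Import numFieldNormedType.Exports.

Local Open Scope classical_set_scope.
Local Open Scope ring_scope.

Section AlternatingDescent.
Variables (R : realType) (n : nat).
Implicit Types (D : set 'rV[R]_n) (f : 'rV[R]_n -> R) (x y z : 'rV[R]_n).

Definition simplex : set 'rV[R]_n :=
  [set x | \sum_i x 0 i = 1 /\ forall i, 0 <= x 0 i].

(* The library norm `|x| on row vectors is the sup norm, so the Euclidean
   norm is written out. *)
Definition l2norm x : R := Num.sqrt (\sum_i x 0 i ^+ 2).

(* A point of D nearest to x; the default value x is returned only when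
   there is no such point, which cannot happen for D closed and nonempty. *)
Definition euclidean_proj D x : 'rV[R]_n :=
  xget x [set y | D y /\ forall z, D z -> l2norm (x - y) <= l2norm (x - z)].

Definition grad f x : 'rV[R]_n := \row_i 'D_(delta_mx 0 i) f x.

Definition pgd_step (eta : R) f x : 'rV[R]_n :=
  euclidean_proj simplex (x - eta *: grad f x).

Definition eg_step (eta : R) f x : 'rV[R]_n :=
  \row_i (x 0 i * expR (- eta * grad f x 0 i) /
          \sum_j x 0 j * expR (- eta * grad f x 0 j)).

(* Time starts at 1: [alt_play eta_euc eta_ent f x1 t] is x^(t) for t >= 1,
   with x^(1) = x1; the value at t = 0 is a dummy. *)
Fixpoint alt_play (eta_euc eta_ent : R) (f : nat -> 'rV[R]_n -> R) x1
    (t : nat) : 'rV[R]_n :=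
  if t is s.+1 then
    let x := alt_play eta_euc eta_ent f x1 s in
    if s == 0%N then x1
    else if odd s then pgd_step eta_euc (f s) x
    else eg_step eta_ent (f s) x
  else x1.

(* On the compact simplex, for continuous losses and n > 0, this infimum is a
   minimum. *)
Definition regret (T : nat) (f : nat -> 'rV[R]_n -> R)
    (x : nat -> 'rV[R]_n) : R :=
  \sum_(1 <= t < T.+1) f t (x t) -
  inf [set \sum_(1 <= t < T.+1) f t y | y in simplex].

End AlternatingDescent.

Arguments simplex R n : clear implicits.

(* Main.v *)
Require Import Defs.
From HB Require Import structures.
From mathcomp Require Import all_boot all_order all_algebra.
From mathcomp Require Import all_classical all_reals all_analysis.
From mathcomp Require Import ring lra zify.

Set Implicit Arguments.
Unset Strict Implicit.
Unset Printing Implicit Defensive.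

Import Order.TTheory GRing.Theory Num.Theory.
Import numFieldNormedType.Exports.

Local Open Scope classical_set_scope.
Local Open Scope ring_scope.

(** The losses are [c_t * q], where [q] is the first coordinate of the point
    played, so that the fixed point [q = 0] pays nothing and it is enough to
    bound the total loss of the player from below.  Rounds are grouped in pairs,
    a gradient round followed by an exponentiated round.  With [N = T %/ 4],
    the pair of coefficients is [(1, -1/2)] in the first [N] pairs (early block)
    and [(-1/2, 1)] in the next [N] pairs (late block); the loss is zero
    afterwards.

    The two updates always pull against each other, and each pair has a positive
    net coefficient: the player should drive [q] to 0.  In both blocks the
    update with the larger coefficient is the one that lowers [q].  A pair costs
    at least half of the value of [q] at the round with coefficient 1
    ([pair_cost_early], [pair_cost_late]), so no pair ever earns anything, and
    it remains to find linearly many pairs in which [q] is bounded away from 0,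
    in one block or the other.

    Put [h = eta_euc / 2], the displacement of [q] per unit of coefficient in a
    gradient round, and [v = eta_ent].
    - If [N * h <= 1/4], the gradient has no time to bring [q] below [1/4] in the
      early block, where exponentiated rounds only raise [q] ([early_drift]).
    - If [h <= 1/4] and [v >= 16 * h], the early exponentiated rounds undo the
      gradient rounds, and [q] is at least [1/2] at every early gradient round
      ([early_half]).
    - If [h >= 1/4], every late gradient round lifts [q] to [1/8] or more
      ([late_ge]), whatever the exponentiated round did before.
    - Otherwise [v <= 16 * h] and [N * h >= 1/4].  Near [q = 0] an exponentiated
      round acts only multiplicatively, hence cannot offset the additive push
      of the late gradient rounds: [q] climbs linearly up to [1/64]
      ([late_ramp]), and [N] pairs suffice for the climb.

    Thus a gradient step that is large compared with the exponentiated one fails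
    in the late block, and one that is small fails in the early block.  This
    gives regret at least [N / 256] for every choice of the step sizes. *)

(** * The two updates on one coordinate *)

Section ScalarSteps.
Variable R : realType.
Implicit Types (q x w h v : R).

Definition clip x : R := Num.max 0 (Num.min 1 x).

(** An exponentiated step read on one coordinate: the odds [q / (1 - q)] are
    multiplied by [expR w]. *)
Definition tilt w q : R := q * expR w / (q * expR w + (1 - q)).

Lemma clip_ge0 x : 0 <= clip x.
Proof. by rewrite le_max lexx. Qed.

Lemma clip_le1 x : clip x <= 1.
Proof. by rewrite ge_max ler01 ge_min lexx. Qed.

Lemma clip_ge x m : m <= 1 -> m <= x -> m <= clip x.
Proof. by move=> m1 mx; rewrite le_max le_min m1 mx orbT. Qed.

Lemma clip_le x m : 0 <= m -> x <= m -> clip x <= m.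
Proof. by move=> m0 xm; rewrite ge_max m0 ge_min xm orbT. Qed.

Lemma tilt_den_gt0 w q : 0 <= q <= 1 -> 0 < q * expR w + (1 - q).
Proof.
move=> /andP[q0 q1]; have e0 := expR_gt0 w.
have := mulr_ge0 q0 (ltW e0).
case: (ltrP q 1) => [|q1'] => ?; first by lra.
have -> : q = 1 by lra.
lra.
Qed.

Lemma tilt_ge0 w q : 0 <= q <= 1 -> 0 <= tilt w q.
Proof.
move=> q01; rewrite divr_ge0 ?(ltW (tilt_den_gt0 _ q01))// mulr_ge0 ?expR_ge0//.
by case/andP: q01.
Qed.

Lemma tilt_le1 w q : 0 <= q <= 1 -> tilt w q <= 1.
Proof.
move=> q01; rewrite ler_pdivrMr ?tilt_den_gt0// mul1r lerDl.
by case/andP: q01; lra.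
Qed.

Lemma tilt01 w q : 0 <= q <= 1 -> 0 <= tilt w q <= 1.
Proof. by move=> q01; rewrite tilt_ge0// tilt_le1. Qed.

Lemma tilt_ge_id w q : 0 <= w -> 0 <= q <= 1 -> q <= tilt w q.
Proof.
move=> w0 q01; rewrite ler_pdivlMr ?tilt_den_gt0//.
case/andP: q01 => q0 q1.
have e1 : 0 <= expR w - 1 by have := expR_ge1Dx w; lra.
have q11 : 0 <= q * (1 - q) by rewrite mulr_ge0//; lra.
rewrite -subr_ge0; set d := (X in 0 <= X).
have -> : d = q * (1 - q) * (expR w - 1) by rewrite /d; ring.
exact: mulr_ge0.
Qed.

(** The normalising denominator is at most 1 when the weight decreases, so the
    relative loss of mass is at most that of the unnormalised update. *)
Lemma tilt_ge_mul v q : 0 <= v -> 0 <= q <= 1 -> q * expR (- v) <= tilt (- v) q.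
Proof.
move=> v0 q01; rewrite ler_pdivlMr ?tilt_den_gt0//.
have e1 : expR (- v) <= 1 by rewrite -expR0 ler_expR; lra.
have := expR_gt0 (- v); case/andP: q01 => q0 q1 e0.
have qe0 := mulr_ge0 q0 (ltW e0).
have e1' : 0 <= 1 - expR (- v) by lra.
rewrite -subr_ge0; set d := (X in 0 <= X).
have -> : d = q * expR (- v) * (q * (1 - expR (- v))) by rewrite /d; ring.
exact/mulr_ge0/mulr_ge0.
Qed.

(** Passing from [2^-1 - h] back to [2^-1] multiplies the odds by
    [(1 + 2 * h) / (1 - 2 * h)], which is at most [1 + 8 * h <= expR w] in the
    given range of [h]. *)
Lemma tilt_ge_half w h q : 0 <= h <= 4^-1 -> 8 * h <= w ->
  2^-1 - h <= q -> q <= 1 -> 2^-1 <= tilt w q.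
Proof.
move=> /andP[h0 h4] hw hq q1.
have q01 : 0 <= q <= 1 by apply/andP; split; lra.
rewrite ler_pdivlMr ?tilt_den_gt0//.
have := expR_ge1Dx w.
nra.
Qed.

End ScalarSteps.

(** * Two blocks of opposite pushes *)

(** [a k] and [b k] are the masses played at the gradient round and at the
    exponentiated round of pair [k]. *)
Section TwoBlocks.
Variables (R : realType) (N : nat) (h v : R) (a b : nat -> R).
Hypotheses (h_gt0 : 0 < h) (v_gt0 : 0 < v) (a0 : a 0%N = 2^-1).
Hypothesis b_early : forall k, (k < N)%N -> b k = clip (a k - h).
Hypothesis a_early : forall k, (k < N)%N -> a k.+1 = tilt (v / 2) (b k).
Hypothesis b_late : forall k, (N <= k < N + N)%N -> b k = clip (a k + h / 2).
Hypothesis a_late : forall k, (N <= k < N + N)%N -> a k.+1 = tilt (- v) (b k).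

Let b01 k : (k < N + N)%N -> 0 <= b k <= 1.
Proof.
case: (ltnP k N) => kN kNN; first by rewrite b_early// clip_ge0 clip_le1.
by rewrite b_late ?kN// clip_ge0 clip_le1.
Qed.

Let a01 k : (k <= N + N)%N -> 0 <= a k <= 1.
Proof.
case: k => [_|k kNN]; first by rewrite a0; apply/andP; split; lra.
have /b01 bk := kNN.
case: (ltnP k N) => kN; first by rewrite a_early// tilt01.
by rewrite a_late ?kN// tilt01.
Qed.

Lemma early_drift k : (k <= N)%N -> 2^-1 - k%:R * h <= a k.
Proof.
elim: k => [_|k IH kN]; first by rewrite a0; lra.
have {IH} := IH (ltnW kN) => IH.
have bk : 0 <= b k <= 1 by apply: b01; lia.
have v2 : 0 <= v / 2 by move: v_gt0; lra.
rewrite a_early//; apply: le_trans (tilt_ge_id v2 bk).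
rewrite b_early//; apply: clip_ge; last by rewrite -(natr1 k); lra.
have : 0 <= k.+1%:R * h by rewrite mulr_ge0// ltW.
lra.
Qed.

(** The value 1/2 is a barrier: one gradient step goes at most [h] below it, and
    an exponentiated step of strength [v / 2 >= 8 * h] makes up for that. *)
Lemma early_half k : h <= 4^-1 -> 16 * h <= v -> (k <= N)%N -> 2^-1 <= a k.
Proof.
move=> h4 hv; elim: k => [_|k IH kN]; first by rewrite a0; lra.
have {IH} := IH (ltnW kN) => IH.
have bk : 0 <= b k <= 1 by apply: b01; lia.
rewrite a_early//; apply: (@tilt_ge_half _ _ h); [by rewrite ltW|lra| |];
  last by case/andP: bk.
by rewrite b_early//; apply: clip_ge; move: h_gt0; lra.
Qed.

Lemma late_ge k : (N <= k < N + N)%N -> Num.min 1 (h / 2) <= b k.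
Proof.
move=> kN; rewrite b_late//.
have /andP[ak _] : 0 <= a k <= 1 by apply: a01; lia.
by apply: clip_ge; rewrite ge_min ?lexx//; apply/orP; right; lra.
Qed.

(** Below the level [64^-1] an exponentiated round loses at most
    [v * 64^-1 <= h / 4], half of the [h / 2] gained in a gradient round; the net
    gain is thus [h / 4] per pair. *)
Lemma late_ramp k : v <= 16 * h -> (k < N)%N ->
  Num.min 64^-1 (k.+1%:R * (h / 4)) <= b (N + k)%N.
Proof.
move=> vh; elim: k => [N0|k IH kN].
  have NN : (N <= N + 0 < N + N)%N by lia.
  apply: le_trans (late_ge NN).
  rewrite mul1r le_min !ge_min; apply/andP; split; apply/orP.
    by left; lra.
  by right; move: h_gt0; lra.
have {IH} := IH (ltnW kN).
set m := Num.min _ _ => mb.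
have m0 : 0 <= m by rewrite le_min mulr_ge0 ?ler0n//=; move: h_gt0; lra.
have m64 : m <= 64^-1 by rewrite ge_min lexx.
have bk : 0 <= b (N + k)%N <= 1 by apply: b01; lia.
have am : m - h / 4 <= a (N + k).+1.
  rewrite a_late; last by lia.
  apply: le_trans (tilt_ge_mul (ltW v_gt0) bk).
  have e0 := expR_gt0 (- v).
  have e1 := expR_ge1Dx (- v).
  apply: (@le_trans _ _ (m * expR (- v))); last by rewrite ler_wpM2r// ltW.
  have me : m * (1 - v) <= m * expR (- v) by rewrite ler_wpM2l.
  have mv : m * v <= m * (16 * h) by rewrite ler_wpM2l.
  have mh : m * h <= 64^-1 * h by rewrite ler_wpM2r// ltW.
  lra.
rewrite addnS b_late; last by lia.
apply: clip_ge; first by rewrite ge_min; apply/orP; left; lra.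
apply: (@le_trans _ _ (m + h / 4)); last by lra.
rewrite /m addr_minl le_min !ge_min; apply/andP; split; apply/orP.
  by left; move: h_gt0; lra.
by right; rewrite -(natr1 k.+1); lra.
Qed.

(** The early gradient round lowers the mass, so the reward collected at the
    exponentiated round is at most half of what was paid just before. *)
Lemma pair_cost_early k : (k < N)%N -> a k / 2 <= a k - b k / 2.
Proof.
move=> kN; have /andP[ak _] : 0 <= a k <= 1 by apply: a01; lia.
suff : b k <= a k by lra.
by rewrite b_early//; apply: clip_le => //; move: h_gt0; lra.
Qed.

Lemma pair_cost_late k : (N <= k < N + N)%N -> b k / 2 <= b k - a k / 2.
Proof.
move=> kN; have /andP[ak a1] : 0 <= a k <= 1 by apply: a01; lia.
suff : a k <= b k by lra.
by rewrite b_late//; apply: clip_ge => //; move: h_gt0; lra.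
Qed.

Lemma cost_lower_bound : N%:R / 256 <=
  \sum_(k < N) (a k - b k / 2) + \sum_(k < N) (b (N + k)%N - a (N + k)%N / 2).
Proof.
have early_ge0 : 0 <= \sum_(k < N) (a k - b k / 2).
  apply: sumr_ge0 => k _; apply: le_trans (pair_cost_early (ltn_ord k)).
  have /andP[] : 0 <= a k <= 1 by apply: a01; have := ltn_ord k; lia.
  lra.
have late_ge0 : 0 <= \sum_(k < N) (b (N + k)%N - a (N + k)%N / 2).
  have kN (k : 'I_N) : (N <= N + k < N + N)%N by have := ltn_ord k; lia.
  apply: sumr_ge0 => k _; apply: le_trans (pair_cost_late (kN k)).
  have /andP[] : 0 <= b (N + k)%N <= 1 by apply: b01; have := kN k; lia.
  lra.
have Nge0 : 0 <= N%:R :> R by [].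
have sum_cst (x : R) : \sum_(k < N) x = N%:R * x.
  by rewrite sumr_const card_ord mulr_natl.
have from_early x : 128^-1 <= x -> (forall k : 'I_N, x <= a k) -> N%:R / 256 <=
  \sum_(k < N) (a k - b k / 2) + \sum_(k < N) (b (N + k)%N - a (N + k)%N / 2).
  move=> x0 xa; apply: ler_wpDr => //.
  apply: (@le_trans _ _ (\sum_(k < N) (x / 2))); first by rewrite sum_cst; nra.
  apply: ler_sum => k _; apply: le_trans (pair_cost_early (ltn_ord k)).
  by have := xa k; lra.
case: (leP (N%:R * h) 4^-1) => hN.
  apply: (from_early 4^-1) => [|k]; first by lra.
  have := early_drift (ltnW (ltn_ord k)).
  have : (k : nat)%:R * h <= N%:R * h.
    by rewrite ler_wpM2r ?(ltW h_gt0)// ler_nat ltnW.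
  lra.
(* Climbing at speed proportional to the index of the pair is enough, since the
   ratios [k.+1 / N] have mean above 1/2. *)
have from_late : (forall k : 'I_N, 64^-1 * (k.+1%:R / N%:R) <= b (N + k)%N) ->
  N%:R / 256 <=
  \sum_(k < N) (a k - b k / 2) + \sum_(k < N) (b (N + k)%N - a (N + k)%N / 2).
  move=> kb; apply: ler_wpDl => //.
  apply: (@le_trans _ _ (\sum_(k < N) (128^-1 * (k.+1%:R / N%:R)))).
    have N1 : N%:R != 0 :> R by apply/eqP => N0; move: hN; rewrite N0; lra.
    rewrite -mulr_sumr -mulr_suml -natr_sum.
    have -> : \sum_(i < N) i.+1 = 'C(N.+1, 2).
      by rewrite -bin2_sum big_mkord big_ord_recl.
    have C2 : 'C(N.+1, 2)%:R * 2 = N%:R * (N%:R + 1) :> R.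
      by rewrite natr1 -!natrM mulnC -(mul_bin_diag N.+1 1) bin1 mulnC.
    have -> : 'C(N.+1, 2)%:R / N%:R = (N%:R + 1) / 2 :> R.
      by apply: (mulIf N1); rewrite divfK//; lra.
    lra.
  apply: ler_sum => k _.
  have kN : (N <= N + k < N + N)%N by have := ltn_ord k; lia.
  by have := pair_cost_late kN; have := kb k; lra.
have ratio (k : 'I_N) : 0 <= (k.+1%:R / N%:R : R) <= 1.
  rewrite divr_ge0//= ler_pdivrMr ?mul1r ?ler_nat//.
  by rewrite ltr0n; case: k => k; lia.
case: (leP h 4^-1) => h4; last first.
  apply: from_late => k; have /andP[r0 r1] := ratio k.
  have kN : (N <= N + k < N + N)%N by have := ltn_ord k; lia.
  apply: le_trans (late_ge kN); rewrite le_min; apply/andP; split; lra.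
case: (leP (16 * h) v) => hv.
  apply: (from_early 2^-1) => [|k]; first by lra.
  exact: early_half (ltnW (ltn_ord k)).
apply: from_late => k; have /andP[r0 r1] := ratio k.
apply: le_trans (late_ramp (ltW hv) (ltn_ord k)).
rewrite le_min; apply/andP; split.
  lra.
have N0 : 0 < N%:R :> R by rewrite ltr0n; case: k {r0 r1} => k; lia.
rewrite mulrCA ler_wpM2l//.
by rewrite ler_pdivrMr//; lra.
Qed.

End TwoBlocks.

(** * Reduction to one coordinate *)

Section TwoPointSimplex.
Variable R : realType.
Implicit Types (q m : R) (x y : 'rV[R]_2).

Definition first_coord_loss (c : R) x : R^o := c * x 0 0.

Fact first_coord_loss_is_linear c : linear (first_coord_loss c).
Proof.
move=> k x y; rewrite /first_coord_loss !mxE.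
by rewrite /GRing.scale/=; ring.
Qed.

HB.instance Definition _ c := GRing.isLinear.Build R 'rV[R]_2 R^o _
  (first_coord_loss c) (first_coord_loss_is_linear c).

Definition mix q : 'rV[R]_2 := \row_i (if i == 0 then q else 1 - q).

Lemma sum_coord2 (F : 'I_2 -> R) : \sum_i F i = F 0 + F 1.
Proof. by rewrite big_ord_recl big_ord1; congr (_ + F _); apply/val_inj. Qed.

Lemma ord2_cases (P : 'I_2 -> Prop) : P 0 -> P 1 -> forall i, P i.
Proof.
move=> P0 P1 [[|[|//]] i2].
  by have -> : Ordinal i2 = 0 by apply/val_inj.
by have -> : Ordinal i2 = 1 by apply/val_inj.
Qed.

Lemma mix0 q : mix q 0 0 = q. Proof. by rewrite mxE. Qed.
Lemma mix1 q : mix q 0 1 = 1 - q. Proof. by rewrite mxE. Qed.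

Lemma simplex2P x : simplex R 2 x <-> exists2 q, 0 <= q <= 1 & x = mix q.
Proof.
split=> [[sx x0]|[q /andP[q0 q1] ->]].
  rewrite sum_coord2 in sx.
  exists (x 0 0); first by rewrite x0/=; have := x0 1; lra.
  by apply/rowP; apply: ord2_cases; rewrite ?mix0 ?mix1//; lra.
split; first by rewrite sum_coord2 mix0 mix1; ring.
by apply: ord2_cases; rewrite ?mix0 ?mix1//; lra.
Qed.

Lemma grad_first_coord_loss c x :
  grad (first_coord_loss c) x = \row_i (if i == 0 then c else 0).
Proof.
apply/rowP => i; rewrite !mxE /derive.
apply: (@lim_near_cst R^o) => //; near=> e.
have e0 : e != 0 by near: e; exact: nbhs_dnbhs_neq.
rewrite /= /first_coord_loss /GRing.scale/= !mxE /=.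
by rewrite eq_sym; case: (i == 0); rewrite /= ?mulr1n ?mulr0n; field.
Unshelve. all: by end_near. Qed.

Lemma clip_nearest m a : 0 <= a <= 1 -> (clip m - m) ^+ 2 <= (a - m) ^+ 2.
Proof.
move=> /andP[a0 a1]; rewrite /clip.
case: (leP 1 m) => m1; first by rewrite max_r //; nra.
case: (leP 0 m) => m0; last by nra.
by rewrite subrr expr0n/= sqr_ge0.
Qed.

Lemma clip_nearest_unique m a : 0 <= a <= 1 ->
  (a - m) ^+ 2 <= (clip m - m) ^+ 2 -> a = clip m.
Proof.
move=> /andP[a0 a1]; rewrite /clip.
case: (leP 1 m) => m1; first by rewrite max_r //; nra.
case: (leP 0 m) => m0; last by nra.
rewrite subrr expr0n/= => h; apply/subr0_eq/eqP.
by rewrite -sqrf_eq0 eq_le h sqr_ge0.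
Qed.

(** A shift of the first coordinate by [d] splits into a move of the mass by
    [d / 2] along the line carrying the simplex and a component orthogonal to
    that line, which is the same for all [a].  Hence the step [eta_euc / 2] in
    [mass]. *)
Lemma l2norm_mix_sub q d a :
  l2norm (mix q - (\row_i (if i == 0 then d else 0)) - mix a) =
  Num.sqrt ((a - (q - d / 2)) ^+ 2 *+ 2 + d ^+ 2 / 2).
Proof. by rewrite /l2norm sum_coord2 !mxE/=; congr Num.sqrt; field. Qed.

Lemma pgd_step_mix eta c q :
  pgd_step eta (first_coord_loss c) (mix q) = mix (clip (q - eta / 2 * c)).
Proof.
rewrite /pgd_step grad_first_coord_loss.
have -> : eta *: \row_i (if i == 0 then c else 0) =
    \row_i (if i == 0 then eta * c else 0) :> 'rV[R]_2.
  by apply/rowP => i; rewrite !mxE; case: ifP; rewrite ?mulr0.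
have -> : eta / 2 * c = eta * c / 2 by field.
set d := eta * c.
have nn (b : R) : 0 <= (b - (q - d / 2)) ^+ 2 *+ 2 + d ^+ 2 / 2.
  by rewrite addr_ge0 ?mulrn_wge0 ?divr_ge0 ?sqr_ge0.
have c01 : 0 <= clip (q - d / 2) <= 1 by rewrite clip_ge0 clip_le1.
have cs : simplex R 2 (mix (clip (q - d / 2))).
  by apply/simplex2P; exists (clip (q - d / 2)).
apply: xget_unique => [|y [/simplex2P[a a01 ->]]].
  split=> [|z /simplex2P[a a01 ->]]; first exact: cs.
  rewrite !l2norm_mix_sub ler_sqrt// lerD2r lerMn2r/=.
  exact: clip_nearest.
move=> /(_ _ cs); rewrite !l2norm_mix_sub ler_sqrt// lerD2r lerMn2r/= => h.
by congr mix; exact: clip_nearest_unique.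
Qed.

Lemma eg_step_mix eta c q : 0 <= q <= 1 ->
  eg_step eta (first_coord_loss c) (mix q) = mix (tilt (- eta * c) q).
Proof.
move=> q01; have den := tilt_den_gt0 (- eta * c) q01.
rewrite /eg_step grad_first_coord_loss.
apply/rowP => i; rewrite mxE sum_coord2 mix0 mix1 !mxE/= mulr0 expR0 mulr1.
case: ifP => _ //; rewrite ?mulr0 ?expR0 ?mulr1 // /tilt.
by field; rewrite gt_eqF.
Qed.

Fixpoint mass (eta_euc eta_ent : R) (c : nat -> R) (t : nat) : R :=
  if t is s.+1 then
    let q := mass eta_euc eta_ent c s in
    if s == 0%N then 2^-1
    else if odd s then clip (q - eta_euc / 2 * c s)
    else tilt (- eta_ent * c s) q
  else 2^-1.

Lemma massSS eta_euc eta_ent (c : nat -> R) t :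
  mass eta_euc eta_ent c t.+2 =
  if odd t.+1 then clip (mass eta_euc eta_ent c t.+1 - eta_euc / 2 * c t.+1)
  else tilt (- eta_ent * c t.+1) (mass eta_euc eta_ent c t.+1).
Proof. by []. Qed.

Lemma mass01 eta_euc eta_ent (c : nat -> R) t :
  0 <= mass eta_euc eta_ent c t <= 1.
Proof.
have half : 0 <= (2^-1 : R) <= 1 by apply/andP; split; lra.
elim: t => [|t IH] //=; case: ifP => // _; case: ifP => _.
  by rewrite clip_ge0 clip_le1.
exact: tilt01.
Qed.

Lemma alt_play_mass eta_euc eta_ent (c : nat -> R) t :
  alt_play eta_euc eta_ent (fun t => first_coord_loss (c t)) (const_mx 2^-1) t =
  mix (mass eta_euc eta_ent c t).
Proof.
have start : const_mx 2^-1 = mix 2^-1.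
  by apply/rowP => i; rewrite !mxE; case: ifP => // _; field.
elim: t => [|t IH] //=; rewrite IH.
case: ifP => // _; case: ifP => _; first exact: pgd_step_mix.
exact/eg_step_mix/mass01.
Qed.

Lemma sum_pairs (F : nat -> R) n :
  \sum_(1 <= t < n.*2.+1) F t = \sum_(k < n) (F k.*2.+1 + F k.*2.+2).
Proof.
elim: n => [|n IH]; first by rewrite big_ord0 big_geq.
by rewrite doubleS big_nat_recr//= big_nat_recr//= IH big_ord_recr /= addrA.
Qed.

(** The comparator is the vertex with [q = 0], whose loss vanishes. *)
Lemma regret_first_coord_loss T (c : nat -> R) (x : nat -> 'rV[R]_2) :
  \sum_(1 <= t < T.+1) c t * x t 0 0 <=
  regret T (fun t => first_coord_loss (c t)) x.
Proof.
rewrite /regret lerBrDr gerDl; apply: ge_inf.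
  exists (- \sum_(1 <= t < T.+1) `|c t|).
  move=> _ [y /simplex2P[q /andP[q0 q1] ->] <-].
  rewrite -sumrN; apply: ler_sum => t _.
  rewrite /first_coord_loss mix0; apply: lerNnormlW.
  by rewrite normrM ler_piMr// ger0_norm.
exists (mix 0); first by apply/simplex2P; exists 0; rewrite ?lexx ?ler01.
by rewrite big1// => t _; rewrite /first_coord_loss mix0 mulr0.
Qed.

(** * The hard losses *)

(** Rounds [2 * k + 1] and [2 * k + 2] form the pair of index [k]; this index is
    [t.-1./2] at round [t]. *)
Definition coef (T t : nat) : R :=
  let N := (T %/ 4)%N in
  if (t.-1./2 < N)%N then (if odd t then 1 else - 2^-1)
  else if (t.-1./2 < N + N)%N then (if odd t then - 2^-1 else 1) else 0.

Lemma coef_le1 T t : `|coef T t| <= 1.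
Proof.
rewrite ler_norml /coef; do 2 case: ifP => _; try (case: ifP => _);
  by apply/andP; split; lra.
Qed.

Lemma first_coord_loss_le1 c x : `|c| <= 1 -> simplex R 2 x ->
  `|first_coord_loss c x| <= 1.
Proof.
move=> c1 /simplex2P[q /andP[q0 q1] ->].
by rewrite /first_coord_loss mix0 normrM mulr_ile1// ger0_norm.
Qed.

Lemma regret_alt_play T eta_euc eta_ent : 0 < eta_euc -> 0 < eta_ent ->
  (T %/ 4)%:R / 256 <= regret T (fun t => first_coord_loss (coef T t))
    (alt_play eta_euc eta_ent (fun t => first_coord_loss (coef T t))
       (const_mx 2^-1)).
Proof.
move=> euc0 ent0; apply: le_trans (regret_first_coord_loss _ _ _).
under eq_bigr do rewrite alt_play_mass mix0.
set q := mass _ _ _; set N := (T %/ 4)%N.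
have NT : ((N + N).*2 <= T)%N by rewrite /N; lia.
rewrite (big_cat_nat (n := (N + N).*2.+1))//= [X in _ + X]big_nat.
rewrite [X in _ + X]big1 ?addr0; last first.
  move=> t /andP[tN _]; rewrite /coef -/N !ifF ?mul0r//; lia.
rewrite sum_pairs big_split_ord /=.
have coefE k :
    (coef T k.*2.+1 = if (k < N)%N then 1
                      else if (k < N + N)%N then - 2^-1 else 0) /\
    (coef T k.*2.+2 = if (k < N)%N then - 2^-1
                      else if (k < N + N)%N then 1 else 0).
  by rewrite /coef -/N /= odd_double uphalf_double doubleK.
have bE k : q k.*2.+2 = clip (q k.*2.+1 - eta_euc / 2 * coef T k.*2.+1).
  by rewrite /q massSS oddS odd_double.
have aE k : q k.*2.+3 = tilt (- eta_ent * coef T k.*2.+2) (q k.*2.+2).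
  by rewrite /q massSS !oddS odd_double.
have PN k : (N <= k < N + N)%N -> (k < N)%N = false by lia.
have := @cost_lower_bound R N (eta_euc / 2) eta_ent (fun k => q k.*2.+1)
  (fun k => q k.*2.+2).
rewrite divr_gt0//.
move=> /(_ isT ent0 erefl) H; apply: le_trans (H _ _ _ _) _ => /=.
- by move=> k kN; rewrite bE (coefE k).1 kN mulr1.
- by move=> k kN; rewrite aE (coefE k).2 kN; congr tilt; field.
- move=> k kN; rewrite bE (coefE k).1 PN//.
  by case/andP: kN => _ ->; congr clip; field.
- move=> k kN; rewrite aE (coefE k).2 PN//.
  by case/andP: kN => _ ->; congr tilt; field.
rewrite le_eqVlt; apply/orP; left; apply/eqP; congr (_ + _);
  apply: eq_bigr => k _.
  by rewrite (coefE _).1 (coefE _).2 ltn_ord; field.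
by rewrite (coefE _).1 (coefE _).2 ltnNge leq_addr/= ltn_add2l ltn_ord; field.
Qed.

End TwoPointSimplex.

Theorem theorem3 (R : realType) :
  exists loss : nat -> nat -> {linear 'rV[R]_2 -> R^o},
    (forall (T t : nat) (x : 'rV[R]_2), simplex R 2 x -> `|loss T t x| <= 1) /\
    exists (c : R) (T0 : nat), 0 < c /\
      forall T : nat, (T0 <= T)%N ->
      forall eta_euc eta_ent : R, 0 < eta_euc -> 0 < eta_ent ->
        c * T%:R <=
        regret T (fun t => loss T t)
          (alt_play eta_euc eta_ent (fun t => loss T t) (const_mx 2^-1)).
Proof.
exists (fun T t => first_coord_loss (coef R T t) : {linear 'rV[R]_2 -> R^o}).
split=> [T t x|]; first exact/first_coord_loss_le1/coef_le1.
exists 2048^-1, 4%N; split=> [|T T4 eta_euc eta_ent euc0 ent0]; first by lra.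
apply: le_trans (regret_alt_play T euc0 ent0).
(* Rounding [T / 4] down loses at most a factor 2 once [T >= 4]. *)
have : T%:R <= (8 * (T %/ 4))%:R :> R by rewrite ler_nat; lia.
rewrite natrM; lra.
Qed.
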